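(* Let $n\geq 1$ be an integer, let $(G_s,+,0)$ and $(G_t,+,0)$ be abelian groups, and let $\varphi:G_s^{\times n}\to G_t$ be a map that is totally symmetric (upper signs below) or totally skew-symmetric (lower signs below), i.e. $\varphi(x_{\sigma(1)},\dots,x_{\sigma(n)})=(\pm1)^{M(\sigma)}\varphi(x_1,\dots,x_n)$ for all permutations $\sigma$ of $\{1,\dots,n\}$ and all $x_1,\dots,x_n\in G_s$, where $M(\sigma)$ is the number of transpositions in $\sigma$. Then the maps $\phi_\varphi,\Phi_\varphi:G_s^{\times n}\to G_t$ defined by $$\phi_\varphi(x_1,\dots,x_n):=n\,\varphi(x_1,\dots,x_n)\mp\sum_{i=1}^{n}\varphi\Bigl(x_1,\dots,x_{i-1},-\sum_{j=1}^{n}x_j,x_{i+1},\dots,x_n\Bigr),$$ $$\Phi_\varphi(x_1,\dots,x_n):=\varphi(x_1,\dots,x_n)\pm\sum_{i=1}^{n}\varphi\Bigl(x_1,\dots,x_{i-1},-\sum_{j=1}^{n}x_j,x_{i+1},\dots,x_n\Bigr)$$ are, respectively, solutions $\phi=\phi_\varphi$ and $\Phi=\Phi_\varphi$ of the hexagon equation $$\phi(x_1,\dots,x_n)\pm\sum_{i=1}^{n}\phi\Bigl(x_1,\dots,x_{i-1},-\sum_{j=1}^{n}x_j,x_{i+1},\dots,x_n\Bigr)=0\quad\forall\,x_1,\dots,x_n\in G_s$$ and of the anti-hexagon equation $$n\,\Phi(x_1,\dots,x_n)\mp\sum_{i=1}^{n}\Phi\Bigl(x_1,\dots,x_{i-1},-\sum_{j=1}^{n}x_j,x_{i+1},\dots,x_n\Bigr)=0\quad\forall\,x_1,\dots,x_n\in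 G_s.$$
   Context: The $\varphi$ are arbitrary set maps (not assumed additive). $(-1)^{M(\sigma)}$ is the sign of the permutation $\sigma$. Throughout, one uses all upper signs when $\varphi$ is symmetric and all lower signs when $\varphi$ is skew-symmetric. *)

(* Defs.v *)
From mathcomp Require Import all_boot all_order all_fingroup all_algebra.

Set Implicit Arguments.
Unset Strict Implicit.
Unset Printing Implicit Defensive.

Import GRing.Theory.
Local Open Scope ring_scope.

(* The upper signs are obtained with [skew = false], the lower signs with
   [skew = true]: "+- y" is [y *~ pm skew] and "-+ y" is [- (y *~ pm skew)]. *)
Definition pm (skew : bool) : int := if skew then -1 else 1.

Section Hexagon.

Variables (n : nat) (Gs Gt : zmodType).

(* [odd_perm s] is the parity of the number of transpositions in any
   decomposition of [s]; the exponent matters only modulo 2. *)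
Definition totally_symmetric (skew : bool) (phi : {ffun 'I_n -> Gs} -> Gt) :=
  forall (s : 'S_n) (x : {ffun 'I_n -> Gs}),
    phi [ffun i => x (s i)] = phi x *~ (pm skew ^+ odd_perm s).

(* (x_1, ..., x_{i-1}, - (x_1 + ... + x_n), x_{i+1}, ..., x_n) *)
Definition subst_negsum (x : {ffun 'I_n -> Gs}) (i : 'I_n) :
    {ffun 'I_n -> Gs} :=
  [ffun k => if k == i then - \sum_(j < n) x j else x k].

Definition hexagon (skew : bool) (phi : {ffun 'I_n -> Gs} -> Gt) :=
  forall x : {ffun 'I_n -> Gs},
    phi x + (\sum_(i < n) phi (subst_negsum x i)) *~ pm skew = 0.

Definition anti_hexagon (skew : bool) (Phi : {ffun 'I_n -> Gs} -> Gt) :=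
  forall x : {ffun 'I_n -> Gs},
    Phi x *+ n - (\sum_(i < n) Phi (subst_negsum x i)) *~ pm skew = 0.

Definition hexagon_sol (skew : bool) (phi : {ffun 'I_n -> Gs} -> Gt)
    (x : {ffun 'I_n -> Gs}) : Gt :=
  phi x *+ n - (\sum_(i < n) phi (subst_negsum x i)) *~ pm skew.

Definition anti_hexagon_sol (skew : bool) (phi : {ffun 'I_n -> Gs} -> Gt)
    (x : {ffun 'I_n -> Gs}) : Gt :=
  phi x + (\sum_(i < n) phi (subst_negsum x i)) *~ pm skew.

End Hexagon.

(* Main.v *)
Require Import Defs.
From mathcomp Require Import all_boot all_order all_fingroup all_algebra.

(** Let [A] be the operator sending [phi] to the sum over [i] of [phi] with
    its [i]-th argument replaced by minus the sum of all arguments. Two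
    successive replacements, at [i] and then at [j], give back the original
    tuple when [j = i], and otherwise the replacement at [j] alone up to the
    transposition of [i] and [j]. Hence [B = +- A] satisfies
    [B^2 = n + (n - 1) B] on (skew-)symmetric maps, i.e. [(1 + B)(n - B) = 0];
    the two assertions are this factorization, read in the two orders. *)

Section Replacement.

Import GRing.Theory.
Local Open Scope ring_scope.

Lemma pmK (skew : bool) (V : zmodType) (v : V) :
  v *~ pm skew *~ pm skew = v.
Proof. by case: skew; rewrite /= ?mulrN1z ?opprK. Qed.

Variables (n : nat) (Gs Gt : zmodType).
Implicit Types (x : {ffun 'I_n -> Gs}) (i j : 'I_n).

(** With S the sum of [x], the new sum is -S + (S - x_i). *)
Lemma sum_subst_negsum x i : \sum_k subst_negsum x i k = - x i.
Proof.
rewrite (bigD1 i) //= ffunE eqxx (bigD1 i) //= opprD -addrA.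
rewrite [X in _ + (_ + X)](_ : _ = \sum_(k | k != i) x k) ?addNr ?addr0 //.
by apply: eq_bigr => k /negPf ki; rewrite ffunE ki.
Qed.

Lemma subst_negsumK x i : subst_negsum (subst_negsum x i) i = x.
Proof.
apply/ffunP => k; rewrite ffunE sum_subst_negsum opprK ffunE.
by case: eqP => [->|].
Qed.

(** Both sides hold minus the sum of [x] at [i], [x i] at [j], and [x k] elsewhere. *)
Lemma subst_negsum_tperm x i j : j != i ->
  subst_negsum (subst_negsum x i) j
    = [ffun k => subst_negsum x j (tperm i j k)].
Proof.
move=> ji; apply/ffunP => k; rewrite ffunE sum_subst_negsum opprK !ffunE.
case: tpermP => [->|->|/eqP/negPf ki /eqP/negPf kj]; last by rewrite kj ki.
- by rewrite eq_sym (negPf ji) !eqxx.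
- by rewrite eqxx eq_sym (negPf ji).
Qed.

Variables (skew : bool) (phi : {ffun 'I_n -> Gs} -> Gt).
Hypothesis phi_sym : totally_symmetric skew phi.

Lemma sum_subst_negsum2 x i :
  \sum_j phi (subst_negsum (subst_negsum x i) j)
    = phi x + (\sum_j phi (subst_negsum x j)) *~ pm skew
      - phi (subst_negsum x i) *~ pm skew.
Proof.
rewrite (bigD1 i) //= subst_negsumK -addrA; congr (_ + _).
(* The subtracted term cancels the index [i], leaving the sum over [j != i] on both sides. *)
rewrite [in RHS](bigD1 i) //= mulrzDl addrAC subrr add0r.
rewrite mulrz_suml; apply: eq_bigr => j ji.
by rewrite subst_negsum_tperm // phi_sym odd_tperm eq_sym ji expr1.
Qed.

(** This is [B^2 = n + (n - 1) B], since [A^2 = B^2]. *)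
Lemma double_sum_subst_negsum x :
  \sum_i \sum_j phi (subst_negsum (subst_negsum x i) j)
    = phi x *+ n + (\sum_j phi (subst_negsum x j)) *~ pm skew *+ n
      - (\sum_j phi (subst_negsum x j)) *~ pm skew.
Proof.
rewrite (eq_bigr _ (fun i _ => sum_subst_negsum2 x i)) sumrB -mulrz_suml.
by rewrite sumr_const card_ord mulrnDl.
Qed.

Lemma hexagon_sol_hexagon : hexagon skew (hexagon_sol skew phi).
Proof.
move=> x; rewrite /hexagon_sol sumrB -mulrz_suml sumrMnl.
(* Read as an integer multiple, [*+ n] commutes with the sign. *)
rewrite double_sum_subst_negsum mulrzBl pmK (pmulrn (bigop _ _ _)) mulrzAC -pmulrn.
by apply/eqP; rewrite addr_eq0 opprB addrAC addrK.
Qed.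

Lemma anti_hexagon_sol_anti_hexagon :
  anti_hexagon skew (anti_hexagon_sol skew phi).
Proof.
move=> x; rewrite /anti_hexagon_sol big_split /= -mulrz_suml.
rewrite double_sum_subst_negsum mulrzDl pmK mulrnDl.
by rewrite [X in _ - X]addrC subrK subrr.
Qed.

End Replacement.

Theorem proposition1p1p1 (n : nat) (hn : 1 <= n) (Gs Gt : zmodType)
    (skew : bool) (phi : {ffun 'I_n -> Gs} -> Gt)
    (hphi : totally_symmetric skew phi) :
  hexagon skew (hexagon_sol skew phi) /\
  anti_hexagon skew (anti_hexagon_sol skew phi).
Proof.
by split; [apply: hexagon_sol_hexagon | apply: anti_hexagon_sol_anti_hexagon].
Qed.
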